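(* Let $n\ge 1$. If $A\in\mathcal{M}_n(\mathbb{R})$, then $W_{\mathbb{H}}(A)$ is convex.
   Context: $\mathbb{H}$ denotes the real quaternions with basis $1,i,j,k$ (with $i^2=j^2=k^2=ijk=-1$), regarded as a $4$-dimensional real vector space when speaking of convexity. For $q\in\mathbb{H}$, $q^*$ is the quaternionic conjugate and $|q|^2=qq^*$. $\mathcal{M}_n(\mathbb{R})$ is the set of $n\times n$ real matrices, regarded as quaternionic matrices via $\mathbb{R}\subset\mathbb{H}$. For an $n\times n$ quaternionic matrix $A$, the quaternionic numerical range is $W_{\mathbb{H}}(A)=\{x^*Ax : x\in\mathbb{H}^n,\ |x|=1\}$, where $x$ is a column vector, $x^*$ its conjugate transpose, and $|x|^2=\sum_l |x_l|^2$. *)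

(* Defs.v *)
From HB Require Import structures.
From mathcomp Require Import all_boot all_order all_algebra ring.
From mathcomp Require Import classical_sets reals convex.

Set Implicit Arguments.
Unset Strict Implicit.
Unset Printing Implicit Defensive.

Import Order.TTheory GRing.Theory Num.Theory.
Local Open Scope classical_set_scope.
Local Open Scope ring_scope.

(* [Quat a b c d] is a + b i + c j + d k. *)
Record quat (R : Type) := Quat { qre : R; qi : R; qj : R; qk : R }.

Definition tuple_of_quat (R : Type) (q : quat R) : R * R * R * R :=
  (qre q, qi q, qj q, qk q).

Definition quat_of_tuple (R : Type) (t : R * R * R * R) : quat R :=
  let: (a, b, c, d) := t in Quat a b c d.

Lemma tuple_of_quatK (R : Type) :
  cancel (@tuple_of_quat R) (@quat_of_tuple R).
Proof. by case. Qed.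

HB.instance Definition _ (R : choiceType) :=
  Choice.copy (quat R) (can_type (@tuple_of_quatK R)).

Section QuatAlgebra.
Variable R : comNzRingType.
Implicit Types (a : R) (p q r : quat R).

Definition quat_zero : quat R := Quat 0 0 0 0.

Definition quat_add p q : quat R :=
  Quat (qre p + qre q) (qi p + qi q) (qj p + qj q) (qk p + qk q).

Definition quat_opp q : quat R := Quat (- qre q) (- qi q) (- qj q) (- qk q).

Lemma quat_addA : associative quat_add.
Proof. by move=> p q r; rewrite /quat_add /= !addrA. Qed.

Lemma quat_addC : commutative quat_add.
Proof. by move=> p q; rewrite /quat_add; congr Quat; rewrite addrC. Qed.

Lemma quat_add0 : left_id quat_zero quat_add.
Proof. by case=> *; rewrite /quat_add /= !add0r. Qed.

Lemma quat_addN : left_inverse quat_zero quat_opp quat_add.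
Proof. by case=> *; rewrite /quat_add /= !addNr. Qed.

HB.instance Definition _ :=
  GRing.isZmodule.Build (quat R) quat_addA quat_addC quat_add0 quat_addN.

Definition quat_one : quat R := Quat 1 0 0 0.

Definition quat_mul p q : quat R :=
  let: Quat a1 b1 c1 d1 := p in
  let: Quat a2 b2 c2 d2 := q in
  Quat (a1 * a2 - b1 * b2 - c1 * c2 - d1 * d2)
       (a1 * b2 + b1 * a2 + c1 * d2 - d1 * c2)
       (a1 * c2 - b1 * d2 + c1 * a2 + d1 * b2)
       (a1 * d2 + b1 * c2 - c1 * b2 + d1 * a2).

Lemma quat_mulA : associative quat_mul.
Proof. by move=> [????] [????] [????]; congr Quat; ring. Qed.

Lemma quat_mul1l : left_id quat_one quat_mul.
Proof. by move=> [????]; congr Quat; ring. Qed.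

Lemma quat_mul1r : right_id quat_one quat_mul.
Proof. by move=> [????]; congr Quat; ring. Qed.

Lemma quat_mulDl : left_distributive quat_mul quat_add.
Proof. by move=> [????] [????] [????]; congr Quat => /=; ring. Qed.

Lemma quat_mulDr : right_distributive quat_mul quat_add.
Proof. by move=> [????] [????] [????]; congr Quat => /=; ring. Qed.

Lemma quat_one_neq0 : quat_one != 0.
Proof. by apply/eqP => -[] /eqP; rewrite oner_eq0. Qed.

HB.instance Definition _ := GRing.Zmodule_isNzRing.Build (quat R)
  quat_mulA quat_mul1l quat_mul1r quat_mulDl quat_mulDr quat_one_neq0.

Definition quat_scale a q : quat R :=
  Quat (a * qre q) (a * qi q) (a * qj q) (a * qk q).

Lemma quat_scaleA a b q :
  quat_scale a (quat_scale b q) = quat_scale (a * b) q.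
Proof. by rewrite /quat_scale /= !mulrA. Qed.

Lemma quat_scale1 : left_id 1 quat_scale.
Proof. by case=> *; rewrite /quat_scale /= !mul1r. Qed.

Lemma quat_scaleDr : right_distributive quat_scale +%R.
Proof. by move=> a p q; rewrite /quat_scale; congr Quat => /=; ring. Qed.

Lemma quat_scaleDl q : {morph quat_scale^~ q : a b / a + b}.
Proof. by move=> a b; rewrite /quat_scale; congr Quat => /=; ring. Qed.

HB.instance Definition _ := GRing.Zmodule_isLmodule.Build R (quat R)
  quat_scaleA quat_scale1 quat_scaleDr quat_scaleDl.

Lemma quat_scaleAl a p q : a *: (p * q) = (a *: p) * q.
Proof. by case: p q => [????] [????]; congr Quat => /=; ring. Qed.

Lemma quat_scaleAr a p q : a *: (p * q) = p * (a *: q).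
Proof. by case: p q => [????] [????]; congr Quat => /=; ring. Qed.

HB.instance Definition _ :=
  GRing.Lmodule_isLalgebra.Build R (quat R) quat_scaleAl.
HB.instance Definition _ :=
  GRing.Lalgebra_isAlgebra.Build R (quat R) quat_scaleAr.

Definition iq : quat R := Quat 0 1 0 0.
Definition jq : quat R := Quat 0 0 1 0.
Definition kq : quat R := Quat 0 0 0 1.

Lemma iqiq : iq * iq = -1. Proof. by congr Quat => /=; ring. Qed.
Lemma jqjq : jq * jq = -1. Proof. by congr Quat => /=; ring. Qed.
Lemma kqkq : kq * kq = -1. Proof. by congr Quat => /=; ring. Qed.
Lemma iqjqkq : iq * jq * kq = -1. Proof. by congr Quat => /=; ring. Qed.

Lemma quatE q :
  q = (qre q)%:A + qi q *: iq + qj q *: jq + qk q *: kq.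
Proof. by case: q => *; congr Quat => /=; ring. Qed.

Definition quat_conj q : quat R := Quat (qre q) (- qi q) (- qj q) (- qk q).

Definition ctmx m n (M : 'M[quat R]_(m, n)) : 'M[quat R]_(n, m) :=
  map_mx quat_conj M^T.

End QuatAlgebra.

Section NumericalRange.
Variable R : rcfType.

Definition quat_norm (q : quat R) : R :=
  Num.sqrt (qre q ^+ 2 + qi q ^+ 2 + qj q ^+ 2 + qk q ^+ 2).

Lemma quat_normE (q : quat R) : (quat_norm q ^+ 2)%:A = q * quat_conj q.
Proof.
rewrite sqr_sqrtr ?addr_ge0 ?sqr_ge0//.
by case: q => *; congr Quat => /=; ring.
Qed.

Definition qvec_norm n (x : 'cV[quat R]_n) : R :=
  Num.sqrt (\sum_l quat_norm (x l 0) ^+ 2).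

(* The 1 x 1 matrix x^* A x is identified with its unique entry. *)
Definition quat_numrange n (A : 'M[quat R]_n) : set (quat R) :=
  [set (ctmx x *m A *m x) 0 0 | x in [set x : 'cV[quat R]_n | qvec_norm x = 1]].

End NumericalRange.

(* Main.v *)
(* Writing x = v + w j with v, w complex vectors, the complex part of x^* A x is
   v^* A v plus the value of the form at conj w, because A is real. By a
   homogeneous form of the Toeplitz-Hausdorff theorem this sum is again in the
   complex numerical range W_C of A. Replacing x by x u with u a unit quaternion
   rotates the imaginary part of x^* A x arbitrarily, so q lies in the
   quaternionic range iff Re q + |Im q| i lies in W_C. Convexity then follows from
   the convexity of W_C, its symmetry under conjugation, and the triangle
   inequality for |Im q|. *)
Require Import Defs.
From mathcomp Require Import all_boot all_order all_algebra.
From mathcomp Require Import classical_sets reals convex.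
From mathcomp Require Import interval_inference ring lra.

Set Implicit Arguments.
Unset Strict Implicit.
Unset Printing Implicit Defensive.

Import Order.TTheory GRing.Theory Num.Theory.
Local Open Scope ring_scope.

(** * Two elementary facts over a real closed field *)

(** The product of the roots is [c / a < 0], so there is a root of each sign; the one whose sign
    matches [e] is taken. *)
Lemma quadratic_root_sign (R : rcfType) (a b c e : R) :
  0 < a -> c < 0 -> exists r, a * r ^+ 2 + b * r + c = 0 /\ 0 <= r * e.
Proof.
move=> a0 c0; set D := b ^+ 2 - 4 * a * c.
have ac0 : a * c < 0 by rewrite pmulr_rlt0.
have b2 : b ^+ 2 <= D by rewrite /D; lra.
have sD2 : Num.sqrt D ^+ 2 = D.
  by rewrite sqr_sqrtr // (le_trans _ b2) ?sqr_ge0.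
have bD : `|b| <= Num.sqrt D by rewrite -sqrtr_sqr ler_wsqrtr.
have /andP[bl br] : - Num.sqrt D <= b <= Num.sqrt D by rewrite -ler_norml.
have an0 : a != 0 by rewrite gt_eqF.
have root s : s ^+ 2 = D ->
    a * ((s - b) / (2 * a)) ^+ 2 + b * ((s - b) / (2 * a)) + c = 0.
  move=> sD; have -> : a * ((s - b) / (2 * a)) ^+ 2 + b * ((s - b) / (2 * a)) + c
    = (s ^+ 2 - D) / (4 * a) by rewrite /D; field.
  by rewrite sD subrr mul0r.
have a20 : 0 <= (2 * a)^-1 by rewrite invr_ge0; lra.
case: (lerP 0 e) => e0.
  exists ((Num.sqrt D - b) / (2 * a)); split; first exact: root.
  by rewrite !mulr_ge0 //; lra.
exists ((- Num.sqrt D - b) / (2 * a)); split; first by apply: root; rewrite sqrrN.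
rewrite mulr_le0 ?(ltW e0) //.
by rewrite mulr_le0_ge0 //; lra.
Qed.

Lemma unit_orthogonal (R : rcfType) (p q : R) :
  exists c s : R, c ^+ 2 + s ^+ 2 = 1 /\ c * p + s * q = 0.
Proof.
have h0 : 0 <= p ^+ 2 + q ^+ 2 by rewrite addr_ge0 ?sqr_ge0.
have [/eqP|h] := eqVneq (p ^+ 2 + q ^+ 2) 0.
  rewrite paddr_eq0 ?sqr_ge0 // !sqrf_eq0 => /andP[/eqP-> /eqP->].
  by exists 1, 0; split; ring.
set k := Num.sqrt (p ^+ 2 + q ^+ 2).
have k2 : k ^+ 2 = p ^+ 2 + q ^+ 2 by rewrite sqr_sqrtr.
have kn0 : k != 0 by rewrite -sqrf_eq0 k2.
exists (- q / k), (p / k); split; last by field.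
by rewrite !exprMn exprVn -mulrDl k2 sqrrN addrC divff.
Qed.

(** * The Toeplitz-Hausdorff theorem for real-valued forms *)

Section ToeplitzHausdorff.
Variables (R : rcfType) (E : lmodType R) (J : E -> E).

(* [J] plays the role of multiplication by [i]: this is what the expansion of a
   hermitian form at [a x + (c + s i) y] looks like over the reals. *)
Definition hermitian (Q : E -> R) := forall x y, exists p q, forall a c s,
  Q (a *: x + c *: y + s *: J y) =
  a ^+ 2 * Q x + (c ^+ 2 + s ^+ 2) * Q y + a * (c * p + s * q).

Lemma hermitianZ Q k x : hermitian Q -> Q (k *: x) = k ^+ 2 * Q x.
Proof.
move=> /(_ x x)[p [q /(_ k 0 0)]]; rewrite !scale0r !addr0 => ->.
by ring.
Qed.

Variables f g N : E -> R.
Hypotheses (hf : hermitian f) (hg : hermitian g) (hN : hermitian N).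

(** By homogeneity it suffices to find [z] with [N z > 0] whose values under [f] and [g] are [N z]
    times the targets. Taking [z] as [a *: x] plus a unit phase times [y], the phase settles one
    real equation and [a] the other. *)
Lemma toeplitz_hausdorff x y t : N x = 1 -> N y = 1 -> 0 <= t <= 1 ->
  exists z, [/\ N z = 1, f z = t * f x + (1 - t) * f y
              & g z = t * g x + (1 - t) * g y].
Proof.
move=> Nx Ny /andP[]; rewrite le_eqVlt => /predU1P[<- _|t0].
  by exists y; split=> //; ring.
rewrite le_eqVlt => /predU1P[->|t1]; first by exists x; split=> //; ring.
set d1 := f x - f y; set d2 := g x - g y; set d := d1 ^+ 2 + d2 ^+ 2.
have d_ge0 : 0 <= d by rewrite addr_ge0 ?sqr_ge0.
have [/eqP|dn0] := eqVneq d 0.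
  rewrite paddr_eq0 ?sqr_ge0 // !sqrf_eq0 !subr_eq0 => /andP[/eqP fxy /eqP gxy].
  by exists x; split=> //; rewrite ?fxy ?gxy; ring.
have d0 : 0 < d by rewrite lt_neqAle eq_sym dn0.
have [pf [qf fE]] := hf x y; have [pg [qg gE]] := hg x y.
have [pN [qN NE]] := hN x y.
(* The phase makes the cross term of [d1 (g - g y N) - d2 (f - f y N)] vanish;
   this form also vanishes at [x] and [y], so all values stay on one line. *)
have [c [s [cs1 cross]]] := unit_orthogonal
  (d1 * (pg - g y * pN) - d2 * (pf - f y * pN))
  (d1 * (qg - g y * qN) - d2 * (qf - f y * qN)).
set rN := c * pN + s * qN.
(* Cross terms of [f - f y * N] and [g - g y * N], two forms that vanish at [y]. *)
set U := c * pf + s * qf - f y * rN; set V := c * pg + s * qg - g y * rN.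
have UV : d1 * V - d2 * U = 0 by rewrite -cross /U /V /rN; ring.
(* Choosing the root with [0 <= a * rN] keeps [N] away from 0. *)
have [a [aE a_ge0]] : exists a, (1 - t) * d * a ^+ 2
    + (d1 * U + d2 * V - t * d * rN) * a + - (t * d) = 0 /\ 0 <= a * rN.
  by apply: quadratic_root_sign; rewrite ?oppr_lt0 ?mulr_gt0 ?subr_gt0.
set M := a ^+ 2 + 1 + a * rN.
have M0 : 0 < M by rewrite /M; have := sqr_ge0 a; lra.
set z := a *: x + c *: y + s *: J y.
have Nz : N z = M by rewrite /z NE Nx Ny cs1 /M /rN; ring.
(* The errors in [f z] and [g z] form a plane vector: its product with [(d1, d2)] is the quadratic
   in [aE], and its determinant against [(d1, d2)] is [a * (d1 * V - d2 * U)]. Both vanish. *)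
have fz : f z = M * (t * f x + (1 - t) * f y).
  apply: (mulfI dn0); apply/eqP; rewrite -subr_eq0; apply/eqP.
  transitivity (d1 * ((1 - t) * d * a ^+ 2
    + (d1 * U + d2 * V - t * d * rN) * a + - (t * d))
    - a * d2 * (d1 * V - d2 * U)); last by rewrite aE UV !mulr0 subrr.
  rewrite /z fE cs1 /M /U /d /d1; ring.
have gz : g z = M * (t * g x + (1 - t) * g y).
  apply: (mulfI dn0); apply/eqP; rewrite -subr_eq0; apply/eqP.
  transitivity (d2 * ((1 - t) * d * a ^+ 2
    + (d1 * U + d2 * V - t * d * rN) * a + - (t * d))
    + a * d1 * (d1 * V - d2 * U)); last by rewrite aE UV !mulr0 addr0.
  rewrite /z gE cs1 /M /V /d /d2; ring.
have k2 : (Num.sqrt M)^-1 ^+ 2 = M^-1 by rewrite exprVn sqr_sqrtr // ltW.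
exists ((Num.sqrt M)^-1 *: z).
by rewrite !hermitianZ // k2 Nz fz gz !mulKf ?mulVf ?gt_eqF.
Qed.

End ToeplitzHausdorff.

(** * The complex numerical range W_C of [A] in real coordinates *)

Section ComplexForms.
Variables (R : rcfType) (n : nat) (A : 'M[R]_n).
Implicit Types z w : 'cV[R]_n * 'cV[R]_n.

(* A pair [(u, v)] of real vectors encodes the complex vector [u + v i]. *)
Definition imul z := (- z.2, z.1).

(** Together with [im_polar], the real and imaginary parts of z^* A w. *)
Definition re_polar z w : R := \sum_l \sum_m
  A l m * (z.1 l 0 * w.1 m 0 + z.2 l 0 * w.2 m 0).
Definition im_polar z w : R := \sum_l \sum_m
  A l m * (z.1 l 0 * w.2 m 0 - z.2 l 0 * w.1 m 0).
Definition re_form z := re_polar z z.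
Definition im_form z := im_polar z z.
Definition sqnorm z : R := \sum_l (z.1 l 0 ^+ 2 + z.2 l 0 ^+ 2).

(** There is no [c * s] term, since y^* A (iy) and (iy)^* A y are opposite; and the form takes the
    same value at [y] and [imul y]. *)
Lemma re_form_hermitian : hermitian imul re_form.
Proof.
move=> x y; exists (re_polar x y + re_polar y x).
exists (re_polar x (imul y) + re_polar (imul y) x) => a c s.
rewrite /re_form /re_polar -!big_split /= !mulr_sumr -!big_split /=.
rewrite mulr_sumr -big_split; apply: eq_bigr => l _ /=.
rewrite -!big_split /= !mulr_sumr -!big_split /= mulr_sumr -big_split.
by apply: eq_bigr => m _ /=; rewrite !mxE; ring.
Qed.

Lemma im_form_hermitian : hermitian imul im_form.
Proof.
move=> x y; exists (im_polar x y + im_polar y x).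
exists (im_polar x (imul y) + im_polar (imul y) x) => a c s.
rewrite /im_form /im_polar -!big_split /= !mulr_sumr -!big_split /=.
rewrite mulr_sumr -big_split; apply: eq_bigr => l _ /=.
rewrite -!big_split /= !mulr_sumr -!big_split /= mulr_sumr -big_split.
by apply: eq_bigr => m _ /=; rewrite !mxE; ring.
Qed.

Lemma sqnorm_hermitian : hermitian imul sqnorm.
Proof.
move=> x y; exists (\sum_l 2 * (x.1 l 0 * y.1 l 0 + x.2 l 0 * y.2 l 0)).
exists (\sum_l 2 * (x.2 l 0 * y.1 l 0 - x.1 l 0 * y.2 l 0)) => a c s.
rewrite /sqnorm !mulr_sumr -!big_split /= mulr_sumr -big_split.
by apply: eq_bigr => l _ /=; rewrite !mxE; ring.
Qed.

Lemma sqnorm_ge0 z : 0 <= sqnorm z.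
Proof. by apply: sumr_ge0 => l _; rewrite addr_ge0 ?sqr_ge0. Qed.

Lemma sqnorm_eq0 z : sqnorm z = 0 -> z = 0.
Proof.
move/eqP; rewrite psumr_eq0 => [/allP z0|l _]; last by rewrite addr_ge0 ?sqr_ge0.
have zl l : z.1 l 0 = 0 /\ z.2 l 0 = 0.
  have := z0 l (mem_index_enum l).
  by rewrite /= paddr_eq0 ?sqr_ge0 // !sqrf_eq0 => /andP[/eqP-> /eqP->].
rewrite [z]surjective_pairing; congr pair; apply/matrixP => l j;
  by rewrite ord1 !mxE; have [] := zl l.
Qed.

Lemma form_convex z w t : sqnorm z = 1 -> sqnorm w = 1 -> 0 <= t <= 1 ->
  exists y, [/\ sqnorm y = 1, re_form y = t * re_form z + (1 - t) * re_form w
              & im_form y = t * im_form z + (1 - t) * im_form w].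
Proof.
exact: (toeplitz_hausdorff re_form_hermitian im_form_hermitian sqnorm_hermitian).
Qed.

(** For nonzero [z] and [w], the sum of the values is the convex combination, with weight
    [sqnorm z], of the values at the normalised vectors. *)
Lemma form_add z w : sqnorm z + sqnorm w = 1 ->
  exists y, [/\ sqnorm y = 1, re_form y = re_form z + re_form w
              & im_form y = im_form z + im_form w].
Proof.
move=> zw1.
have form0 Q : hermitian imul Q -> Q 0 = 0.
  by move=> /(hermitianZ 0 0); rewrite scale0r expr0n mul0r.
have [z0|zn0] := eqVneq (sqnorm z) 0.
  exists w; rewrite (sqnorm_eq0 z0) (form0 _ re_form_hermitian).
  by rewrite (form0 _ im_form_hermitian) !add0r -zw1 z0 add0r.
have [w0|wn0] := eqVneq (sqnorm w) 0.
  exists z; rewrite (sqnorm_eq0 w0) (form0 _ re_form_hermitian).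
  by rewrite (form0 _ im_form_hermitian) !addr0 -zw1 w0 addr0.
have scale2 x : (Num.sqrt (sqnorm x))^-1 ^+ 2 = (sqnorm x)^-1.
  by rewrite exprVn sqr_sqrtr ?sqnorm_ge0.
have w1 : sqnorm w = 1 - sqnorm z by rewrite -zw1; ring.
have [||| y [y1 rey imy]] :=
    @form_convex ((Num.sqrt (sqnorm z))^-1 *: z)
   ((Num.sqrt (sqnorm w))^-1 *: w) (sqnorm z).
- by rewrite (hermitianZ _ _ sqnorm_hermitian) scale2 mulVf.
- by rewrite (hermitianZ _ _ sqnorm_hermitian) scale2 mulVf.
- by rewrite sqnorm_ge0 -subr_ge0 -w1 sqnorm_ge0.
exists y; split=> //.
  rewrite rey (hermitianZ _ _ re_form_hermitian) (hermitianZ _ _ re_form_hermitian).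
  by rewrite !scale2 -w1 !mulVKf.
rewrite imy (hermitianZ _ _ im_form_hermitian) (hermitianZ _ _ im_form_hermitian).
by rewrite !scale2 -w1 !mulVKf.
Qed.

End ComplexForms.

(** * Reduction of the quaternionic range to W_C *)

Section NumericalRangeOfRealMatrix.
Variables (R : rcfType) (n : nat) (A : 'M[R]_n).
Implicit Types (p q u : quat R) (x : 'cV[quat R]_n).

Local Notation W := (quat_numrange (map_mx (in_alg (quat R)) A)).

Definition quat_sq q : R := qre q ^+ 2 + qi q ^+ 2 + qj q ^+ 2 + qk q ^+ 2.
Definition qform x : quat R :=
  \sum_l \sum_m A l m *: (quat_conj (x l 0) * x m 0).

Lemma qformE x : (ctmx x *m map_mx (in_alg (quat R)) A *m x) 0 0 = qform x.
Proof.
rewrite mxE /qform exchange_big /=; apply: eq_bigr => m _.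
rewrite mxE mulr_suml; apply: eq_bigr => l _; rewrite !mxE /=.
by rewrite -scalerAr mulr1 scalerAl.
Qed.

Lemma quat_numrangeP q :
  W q <-> exists2 x : 'cV[quat R]_n, \sum_l quat_sq (x l 0) = 1 & qform x = q.
Proof.
have sqE x : \sum_l quat_norm (x l 0) ^+ 2 = \sum_l quat_sq (x l 0).
  apply: eq_bigr => l _; rewrite sqr_sqrtr //.
  by rewrite !addr_ge0 ?sqr_ge0.
split=> [[x /= x1 <-]|[x x1 <-]]; exists x; rewrite ?qformE //=.
  rewrite -sqE -[LHS]sqr_sqrtr; first by rewrite -/(qvec_norm x) x1 expr1n.
  by apply: sumr_ge0 => l _; rewrite sqr_ge0.
by rewrite /qvec_norm sqE x1 sqrtr1.
Qed.

(** Multiply the vector by [u] on the right; the quaternion norm is multiplicative. *)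
Lemma quat_numrange_conj u q : quat_sq u = 1 -> W q -> W (quat_conj u * q * u).
Proof.
move=> u1 /quat_numrangeP[x x1 <-]; apply/quat_numrangeP.
exists (\col_l (x l 0 * u)).
  rewrite -x1; apply: eq_bigr => l _; rewrite mxE -[RHS]mulr1 -u1.
  by case: (x l 0) u {u1} => [????] [????]; rewrite /quat_sq /=; ring.
rewrite /qform mulr_sumr mulr_suml; apply: eq_bigr => l _.
rewrite mulr_sumr mulr_suml; apply: eq_bigr => m _; rewrite !mxE.
rewrite -scalerAr -scalerAl; congr (_ *: _).
rewrite !mulrA; congr (_ * _ * _).
by case: (x l 0) u {u1} => [????] [????]; congr Quat => /=; ring.
Qed.

Lemma quat_rotation q m : m ^+ 2 = qi q ^+ 2 + qj q ^+ 2 + qk q ^+ 2 ->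
  exists2 u, quat_sq u = 1 & quat_conj u * q * u = Quat (qre q) m 0 0.
Proof.
case: q => a b c d /= m2.
set V := (b + m) ^+ 2 + c ^+ 2 + d ^+ 2.
(* If the bisector is zero, the imaginary part is [- m] times i, and conjugation by j flips its
   sign. *)
have [V0|Vn0] := eqVneq V 0.
  have /eqP := V0; rewrite paddr_eq0 ?addr_ge0 ?sqr_ge0 //.
  rewrite paddr_eq0 ?sqr_ge0 // !sqrf_eq0 addr_eq0 => /andP[/andP[]].
  move=> /eqP-> /eqP-> /eqP->.
  by exists (jq R); [rewrite /quat_sq /=; ring | congr Quat => /=; ring].
have k2 : (Num.sqrt V)^-1 ^+ 2 = V^-1.
  by rewrite exprVn sqr_sqrtr // !addr_ge0 ?sqr_ge0.
set k := (Num.sqrt V)^-1 in k2.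
have k2V : k ^+ 2 * V = 1 by rewrite k2 mulVf.
(* Rotation by pi about the bisector [q + m i] of the two imaginary parts. *)
exists (Quat 0 (k * (b + m)) (k * c) (k * d)).
  by rewrite /quat_sq /= -k2V /V; ring.
(* Both imaginary parts have the same length, so twice the inner product of that of [q] with the
   bisector is [V]. *)
have V2 : 2 * (b * (b + m) + c ^+ 2 + d ^+ 2) = V.
  have -> : V = 2 * (b * (b + m) + c ^+ 2 + d ^+ 2)
    + (m ^+ 2 - (b ^+ 2 + c ^+ 2 + d ^+ 2)) by rewrite /V; ring.
  by rewrite m2 subrr addr0.
congr Quat => /=.
- transitivity (k ^+ 2 * V * a); last by rewrite k2V mul1r.
  by rewrite /V; ring.
- transitivity (k ^+ 2 * (2 * (b * (b + m) + c ^+ 2 + d ^+ 2) * (b + m) - V * b)).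
    by rewrite /V; ring.
  transitivity (k ^+ 2 * V * m); last by rewrite k2V mul1r.
  by rewrite V2; ring.
- transitivity (k ^+ 2 * (2 * (b * (b + m) + c ^+ 2 + d ^+ 2) - V) * c).
    by rewrite /V; ring.
  by rewrite V2; ring.
- transitivity (k ^+ 2 * (2 * (b * (b + m) + c ^+ 2 + d ^+ 2) - V) * d).
    by rewrite /V; ring.
  by rewrite V2; ring.
Qed.

Lemma quat_rotationV u p q : quat_sq u = 1 ->
  quat_conj u * p * u = q -> quat_conj (quat_conj u) * q * quat_conj u = p.
Proof.
move=> u1 <-.
have uV : quat_conj (quat_conj u) * quat_conj u = 1.
  case: u u1 => a b c d /= u1; congr Quat => /=; rewrite -?u1 /quat_sq /=; ring.
have uU : u * quat_conj u = 1.
  case: u u1 {uV} => a b c d /= u1; congr Quat => /=; rewrite -?u1 /quat_sq /=; ring.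
by rewrite !mulrA uV mul1r -mulrA uU mulr1.
Qed.

Lemma qre_qform x : qre (qform x) = \sum_l \sum_m A l m *
  (qre (x l 0) * qre (x m 0) + qi (x l 0) * qi (x m 0)
   + qj (x l 0) * qj (x m 0) + qk (x l 0) * qk (x m 0)).
Proof.
rewrite /qform (big_morph (@qre R) (fun _ _ => erefl) erefl).
apply: eq_bigr => l _; rewrite (big_morph (@qre R) (fun _ _ => erefl) erefl).
apply: eq_bigr => m _ /=.
by case: (x l 0) (x m 0) => [????] [????] /=; ring.
Qed.

Lemma qi_qform x : qi (qform x) = \sum_l \sum_m A l m *
  (qre (x l 0) * qi (x m 0) - qi (x l 0) * qre (x m 0)
   - qj (x l 0) * qk (x m 0) + qk (x l 0) * qj (x m 0)).
Proof.
rewrite /qform (big_morph (@qi R) (fun _ _ => erefl) erefl).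
apply: eq_bigr => l _; rewrite (big_morph (@qi R) (fun _ _ => erefl) erefl).
apply: eq_bigr => m _ /=.
by case: (x l 0) (x m 0) => [????] [????] /=; ring.
Qed.

(* Writing [x = v + w j] with [v], [w] complex, the complex part of [x^* A x] is
   [v^* A v] plus the value of the form at the conjugate of [w]. *)
Lemma quat_numrange_complex_part q : W q ->
  exists z, [/\ sqnorm z = 1, re_form A z = qre q & im_form A z = qi q].
Proof.
move=> /quat_numrangeP[x x1 <-].
pose v : 'cV[R]_n * 'cV[R]_n := (\col_l qre (x l 0), \col_l qi (x l 0)).
(* The coefficient of j on the right is [qj + qk i]; this pair is its conjugate. *)
pose w : 'cV[R]_n * 'cV[R]_n := (\col_l qj (x l 0), \col_l - qk (x l 0)).
have [|z [z1 rez imz]] := @form_add R n A v w.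
  rewrite -x1 -big_split; apply: eq_bigr => l _ /=.
  by rewrite !mxE /quat_sq; ring.
exists z; split=> //; rewrite ?rez ?imz ?qre_qform ?qi_qform -big_split;
  apply: eq_bigr => l _ /=; rewrite -big_split; apply: eq_bigr => m _ /=;
  by rewrite !mxE; ring.
Qed.

Lemma quat_numrange_of_complex z : sqnorm z = 1 ->
  W (Quat (re_form A z) (im_form A z) 0 0).
Proof.
move=> z1; apply/quat_numrangeP.
exists (\col_l Quat (z.1 l 0) (z.2 l 0) 0 0).
  by rewrite -z1; apply: eq_bigr => l _; rewrite mxE /quat_sq /=; ring.
have eta q : q = Quat (qre q) (qi q) (qj q) (qk q) by case: q.
rewrite [LHS]eta qre_qform qi_qform; congr Quat.
- by apply: eq_bigr => l _; apply: eq_bigr => m _; rewrite !mxE /=; ring.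
- by apply: eq_bigr => l _; apply: eq_bigr => m _; rewrite !mxE /=; ring.
- rewrite /qform (big_morph (@qj R) (fun _ _ => erefl) erefl) big1 // => l _.
  rewrite (big_morph (@qj R) (fun _ _ => erefl) erefl) big1 // => m _ /=.
  by rewrite !mxE /=; ring.
- rewrite /qform (big_morph (@qk R) (fun _ _ => erefl) erefl) big1 // => l _.
  rewrite (big_morph (@qk R) (fun _ _ => erefl) erefl) big1 // => m _ /=.
  by rewrite !mxE /=; ring.
Qed.

Definition im_norm q : R := Num.sqrt (qi q ^+ 2 + qj q ^+ 2 + qk q ^+ 2).

Lemma im_norm_sq q : im_norm q ^+ 2 = qi q ^+ 2 + qj q ^+ 2 + qk q ^+ 2.
Proof. by rewrite sqr_sqrtr // !addr_ge0 ?sqr_ge0. Qed.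

Lemma quat_numrange_complexP q : W q <->
  exists z, [/\ sqnorm z = 1, re_form A z = qre q & im_form A z = im_norm q].
Proof.
have [u u1 uq] := quat_rotation (im_norm_sq q).
split=> [Wq|[z [z1 rez imz]]].
  have := quat_numrange_conj u1 Wq; rewrite uq.
  by move=> /quat_numrange_complex_part.
have := quat_numrange_of_complex z1; rewrite rez imz => Wz.
rewrite -(quat_rotationV u1 uq); apply: quat_numrange_conj Wz.
by rewrite -u1 /quat_sq /= !sqrrN.
Qed.

Lemma im_norm_convex p q t : 0 <= t <= 1 ->
  im_norm (t *: p + (1 - t) *: q) <= t * im_norm p + (1 - t) * im_norm q.
Proof.
move=> /andP[t0 t1]; have s0 : 0 <= 1 - t by rewrite subr_ge0.
have np0 : 0 <= im_norm p by rewrite sqrtr_ge0.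
have nq0 : 0 <= im_norm q by rewrite sqrtr_ge0.
have cs : qi p * qi q + qj p * qj q + qk p * qk q <= im_norm p * im_norm q.
  rewrite (le_trans (ler_norm _)) // -ler_sqr ?nnegrE ?mulr_ge0 ?normr_ge0 //.
  rewrite real_normK ?num_real // exprMn !im_norm_sq -subr_ge0.
  (* Lagrange's identity, giving Cauchy-Schwarz. *)
  rewrite [X in 0 <= X](_ : _ = (qi p * qj q - qj p * qi q) ^+ 2
    + (qj p * qk q - qk p * qj q) ^+ 2 + (qk p * qi q - qi p * qk q) ^+ 2).
    by rewrite !addr_ge0 ?sqr_ge0.
  by ring.
rewrite -ler_sqr ?nnegrE ?addr_ge0 ?mulr_ge0 ?sqrtr_ge0 //.
rewrite sqrrD !exprMn !im_norm_sq /= -subr_ge0.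
rewrite [X in 0 <= X](_ : _ = 2 * (t * (1 - t)) * (im_norm p * im_norm q
  - (qi p * qi q + qj p * qj q + qk p * qk q))); last by ring.
by rewrite !mulr_ge0 ?subr_ge0.
Qed.

(** Convexity of W_C gives a point with the right real part but a possibly too large imaginary part;
    the target lies on the vertical segment from it to its conjugate. *)
Lemma quat_numrange_combination p q t : 0 <= t <= 1 -> W p -> W q ->
  W (t *: p + (1 - t) *: q).
Proof.
move=> t01 /quat_numrange_complexP[z [z1 rez imz]].
move=> /quat_numrange_complexP[w [w1 rew imw]].
have [y [y1 rey imy]] := form_convex A z1 w1 t01.
set r := t *: p + (1 - t) *: q.
have rer : re_form A y = qre r by rewrite rey rez rew.
have ry : im_norm r <= im_form A y by rewrite imy imz imw im_norm_convex.
have r0 : 0 <= im_norm r by rewrite sqrtr_ge0.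
apply/quat_numrange_complexP.
have [y0|yn0] := eqVneq (im_form A y) 0.
  by exists y; split=> //; apply/eqP; rewrite eq_le ry y0 r0.
have y_gt0 : 0 < im_form A y by rewrite lt_neqAle eq_sym yn0 (le_trans r0).
(* The conjugate vector: as [A] is real, its value is the conjugate one. *)
pose c : 'cV[R]_n * 'cV[R]_n := (y.1, - y.2).
have c1 : sqnorm c = 1.
  by rewrite -y1; apply: eq_bigr => l _; rewrite /= !mxE sqrrN.
have rec : re_form A c = re_form A y.
  by apply: eq_bigr => l _; apply: eq_bigr => m _; rewrite /= !mxE mulrNN.
have imc : im_form A c = - im_form A y.
  rewrite /im_form /im_polar -sumrN; apply: eq_bigr => l _; rewrite -sumrN.
  by apply: eq_bigr => m _; rewrite /= !mxE; ring.
(* The weight [s] solves [(2 * s - 1) * im_form A y = im_norm r]. *)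
have [|v [v1 rev imv]] := form_convex A y1 c1 (t := (1 + im_norm r / im_form A y) / 2).
  have d0 : 0 <= im_norm r / im_form A y by rewrite divr_ge0 // ltW.
  have d1 : im_norm r / im_form A y <= 1 by rewrite ler_pdivrMr // mul1r.
  by apply/andP; split; lra.
exists v; split=> //; first by rewrite rev rec -rer; ring.
by rewrite imv imc; field.
Qed.

End NumericalRangeOfRealMatrix.

Theorem theorem3p6 (R : realType) (n : nat) (hn : (0 < n)%N) (A : 'M[R]_n) :
  convex_set (quat_numrange (map_mx (in_alg (quat R)) A)).
Proof.
move=> p q t; rewrite !inE => Wp Wq.
by apply: quat_numrange_combination => //; rewrite ge0 le1.
Qed.
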